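(* Consider finite collocation sets $\Omega^h\subset\Omega$ and $\Gamma^h\subset\Gamma$. Let $L\ge2$ and let $\mathcal H$ denote the set of depth-$L$ neural networks $\mathbb{R}^d\to\mathbb{R}^c$ (restricted to $\overline\Omega$, arbitrary hidden-layer widths) with either (i) ReLU activation functions, or (ii) non-polynomial activation functions $\sigma\in C(\mathbb{R})$ that are strictly monotone if $L>2$, or (iii) activation $\sigma\in C^{\ell}(\mathbb{R},\mathbb{R})$, $\ell:=|\Omega^h\cup\Gamma^h|$, satisfying $\sigma^{(k)}(a)\ne0$ for some $a\in\mathbb{R}$ and all $0\le k\le\ell$, that are strictly monotone if $L>2$. If $\arg\min_{u_\theta\in\mathcal H}\mathcal J_\theta(u_\theta)$ has a solution, then it has infinitely many solutions in $\mathcal H$.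
   Context: $\Omega\subset\mathbb{R}^d$ is a bounded domain (open, connected) with Lipschitz boundary, $\Gamma\subseteq\partial\Omega$, and $\Omega^h\cap\Gamma^h=\emptyset$. $\mathcal F_h$ and $\mathcal B_h$ are finite-difference discretizations of differential operators: for a function $u$ with values in $\mathbb{R}^c$ defined on $\Omega^h\cup\Gamma^h$, $\mathcal F_h(u(z))\in\mathbb{R}^{c_{\mathcal F}}$ for $z\in\Omega^h$ and $\mathcal B_h(u(z))\in\mathbb{R}^{c_{\mathcal B}}$ for $z\in\Gamma^h$ denote the values at $z$ of the discrete operators applied to $u$; they depend only on the values of $u$ on $\Omega^h\cup\Gamma^h$ (possibly at neighbouring grid points). $\mathcal D^h\subseteq\Omega^h\cup\Gamma^h$ is the set of data locations with data $u^*(z)\in\mathbb{R}^c$; $\alpha_{\mathcal F},\alpha_{\mathcal B},\alpha_{\mathcal D}\ge0$; $\omega_{\mathcal F}^z,\omega_{\mathcal B}^z,\omega_{\mathcal D}^z\in\mathbb{R}$ are quadrature weights; $\nu\in[1,\infty)$ and $|\cdot|_\nu$ is the $\ell^\nu$-norm. The FD-PINN loss of a neural network $u_\theta$ is $$\mathcal J_\theta(u_\theta)=\alpha_{\mathcal F}\sum_{z\in\Omega^h}\omega_{\mathcal F}^z|\mathcal F_h(u_\theta(z))|_\nu^\nu+\alpha_{\mathcal B}\sum_{z\in\Gamma^h}\omega_{\mathcal B}^z|\mathcal B_h(u_\theta(z))|_\nu^\nu+\alpha_{\mathcal D}\sum_{z\in\mathcal D^h}\omega_{\mathcal D}^z|u_\theta(z)-u^*(z)|_\nu^\nu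 .$$ Minimizers are global minimizers. A depth-$L$ neural network with activation $\sigma:\mathbb{R}\to\mathbb{R}$ is a map $f:\mathbb{R}^d\to\mathbb{R}^c$ of the form $\varphi_0(x)=x$, $\varphi_i(x)=\sigma(W_i\varphi_{i-1}(x)+b_i)$ for $i=1,\dots,L-1$ ($\sigma$ componentwise), $f(x)=W_L\varphi_{L-1}(x)+b_L$, with $W_i\in\mathbb{R}^{d_i\times d_{i-1}}$, $b_i\in\mathbb{R}^{d_i}$, $d_0=d$, $d_L=c$, hidden widths $d_i\in\mathbb{N}$. ReLU is $\sigma(x)=\max\{0,x\}$. Elements of $\mathcal H$ are regarded as functions on $\overline\Omega$ (distinct solutions are distinct functions). *)

(* Defs.v *)
From HB Require Import structures.
From mathcomp Require Import all_boot all_order all_algebra finmap.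
From mathcomp Require Import all_classical all_reals all_analysis.

Set Implicit Arguments.
Unset Strict Implicit.
Unset Printing Implicit Defensive.

Import Order.TTheory GRing.Theory Num.Theory.
Import numFieldNormedType.Exports.

Local Open Scope classical_set_scope.
Local Open Scope ring_scope.

Definition boundary (T : topologicalType) (A : set T) : set T :=
  closure A `\` A°.

Definition dotc (R : realType) (d : nat) (x y : 'cV[R]_d) : R :=
  \sum_i x i 0 * y i 0.

(* Near each boundary point, Omega is the strict epigraph of a Lipschitz
   function in some orthonormal frame. The frame enters only through its last
   axis, a Euclidean unit vector e: the last coordinate of x is <x, e>, and the
   remaining ones are those of the projection x - <x, e> e onto the hyperplane
   orthogonal to e. Only the restriction of g to that hyperplane matters.
   The ball is that of the sup norm, which does not affect the notion. *)
Definition lipschitz_boundary (R : realType) (d : nat)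
    (Omega : set 'cV[R]_d) : Prop :=
  forall p, boundary Omega p ->
    exists (e : 'cV[R]_d) (g : 'cV[R]_d -> R) (r : R),
      [/\ dotc e e = 1, lipschitz g, 0 < r &
          forall x, ball p r x ->
            (Omega x <-> g (x - dotc x e *: e) < dotc x e)].

Definition lipschitz_domain (R : realType) (d : nat)
    (Omega : set 'cV[R]_d) : Prop :=
  [/\ Omega !=set0, open Omega, connected Omega, bounded_set Omega
    & lipschitz_boundary Omega].

Definition lnorm (R : realType) (nu : R) (n : nat) (x : 'cV[R]_n) : R :=
  (\sum_i `|x i 0| `^ nu) `^ nu^-1.

(* The discrete operators act on grid functions, so that they depend only on
   the values of u on Oh `|` Gh. *)
Definition fdpinn_loss (R : realType) (d c cF cB : nat)
    (Oh Gh Dh : {fset 'cV[R]_d}) (nu alphaF alphaB alphaD : R)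
    (Fh : ((Oh `|` Gh)%fset -> 'cV[R]_c) -> Oh -> 'cV[R]_cF)
    (Bh : ((Oh `|` Gh)%fset -> 'cV[R]_c) -> Gh -> 'cV[R]_cB)
    (omegaF : Oh -> R) (omegaB : Gh -> R) (omegaD : Dh -> R)
    (ustar : Dh -> 'cV[R]_c) (u : 'cV[R]_d -> 'cV[R]_c) : R :=
  let uh := fun z : (Oh `|` Gh)%fset => u (fsval z) in
  alphaF * (\sum_(z : Oh) omegaF z * lnorm nu (Fh uh z) `^ nu)
  + alphaB * (\sum_(z : Gh) omegaB z * lnorm nu (Bh uh z) `^ nu)
  + alphaD * (\sum_(z : Dh) omegaD z * lnorm nu (u (fsval z) - ustar z) `^ nu).

(* hidden_layer sigma i phi: phi is a possible i-th hidden map of a network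
   on R^d. *)
Inductive hidden_layer (R : realType) (sigma : R -> R) (d : nat) :
    nat -> forall n : nat, ('cV[R]_d -> 'cV[R]_n) -> Prop :=
| hidden_layer0 : hidden_layer sigma 0 (fun x : 'cV[R]_d => x)
| hidden_layerS (i m n : nat) (phi : 'cV[R]_d -> 'cV[R]_m)
    (W : 'M[R]_(n, m)) (b : 'cV[R]_n) :
    (0 < n)%N -> hidden_layer sigma i phi ->
    hidden_layer sigma i.+1 (fun x => map_mx sigma (W *m phi x + b)).

Definition neural_network (R : realType) (sigma : R -> R) (d c L : nat) :
    set ('cV[R]_d -> 'cV[R]_c) :=
  [set f | exists (n : nat) (phi : 'cV[R]_d -> 'cV[R]_n)
             (W : 'M[R]_(c, n)) (b : 'cV[R]_c),
     hidden_layer sigma L.-1 phi /\ f = (fun x => W *m phi x + b)].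

(* Functions on the closure of Omega are represented by their extension by 0,
   so that equality of elements is equality on the closure. *)
Definition network_class (R : realType) (sigma : R -> R) (d c L : nat)
    (Omega : set 'cV[R]_d) : set ('cV[R]_d -> 'cV[R]_c) :=
  [set f \_ (closure Omega) | f in @neural_network R sigma d c L].

Definition argmin (R : realType) (U : Type) (H : set U) (J : U -> R) : set U :=
  [set u | H u /\ forall v, H v -> J u <= J v].

Definition relu (R : realType) (x : R) : R := Num.max 0 x.

Definition polynomial_fun (R : realType) (sigma : R -> R) : Prop :=
  exists p : {poly R}, forall x, sigma x = p.[x].

Definition strictly_monotone (R : realType) (sigma : R -> R) : Prop :=
  (forall x y, x < y -> sigma x < sigma y) \/
  (forall x y, x < y -> sigma y < sigma x).

Definition class_C (R : realType) (l : nat) (sigma : R -> R) : Prop :=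
  (forall k, (k < l)%N -> forall x, derivable (derive1n k sigma) x 1) /\
  continuous (derive1n l sigma).

(* Main.v *)
Require Import Defs.
From HB Require Import structures.
From mathcomp Require Import all_boot all_order all_algebra finmap.
From mathcomp Require Import all_classical all_reals all_analysis.
From mathcomp Require Import ring zify.

Set Implicit Arguments.
Unset Strict Implicit.
Unset Printing Implicit Defensive.

Import Order.TTheory GRing.Theory Num.Theory.
Import numFieldNormedType.Exports.

Local Open Scope classical_set_scope.
Local Open Scope ring_scope.

(** The loss only sees the values of a network on the finite grid
    [Z = Oh `|` Gh]. It is therefore enough to find a network [g] of depth [L]
    that vanishes on [Z] but not at some point [y] of [Omega]: if [f] is a
    minimizer, then so are all the networks [f + n g], and they differ at [y].
    That [f + n g] is again a network of depth [L] is [neural_network_lincomb],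
    since hidden widths are arbitrary. A point [y] of [Omega] outside [Z] exists
    because a nonempty open set of positive dimension is infinite.

    The network [g] comes from interpolation at the [N + 1] points of [Z] and
    [y], where [N = #|` Z|]. All three assumptions on the activation are used
    through the same consequences: [sigma] is continuous, is not a polynomial of
    degree less than [N], and, for [L > 2], can keep finitely many points apart
    through layers of width one ([separating]). In case (iii) a polynomial of
    degree less than [N] is excluded because its [N]-th derivative vanishes
    identically.

    After a generic linear form and layers of width one
    ([separating_hidden_layer]) the points become [N + 1] distinct reals [s i],
    and it remains to interpolate on the line with the neurons
    [x |-> sigma (t * x + b)] ([interpolation]). If this failed, duality would
    give a nonzero vector [c] such that [\sum_i c i * sigma (t * s i + b) = 0]
    for all [t] and [b]. Varying [t] and [b] together eliminates the points one
    at a time, each at the price of one finite difference ([fdiff_iter_eq0]), so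
    that the [N]-th differences of [sigma] vanish for every step. By a theorem
    of Fréchet ([frechet_polynomial]) the continuous function [sigma] is then a
    polynomial of degree less than [N], a contradiction. *)

(** * Polynomials and finite differences *)

Lemma poly_nat_nonroot (R : numDomainType) (p : {poly R}) :
  p != 0 -> exists n : nat, p.[n%:R] != 0.
Proof.
move=> p0; apply: contrapT => /forallNP nroot.
suff : p = 0 by move/eqP: p0.
apply: (@roots_geq_poly_eq0 _ _ [seq n%:R | n <- iota 0 (size p)]).
- by apply/allP => _ /mapP[n _ ->]; apply/rootP/eqP/negPn/negP/nroot.
- by rewrite map_inj_uniq ?iota_uniq// => m n /eqP; rewrite eqr_nat => /eqP.
- by rewrite size_map size_iota.
Qed.

Lemma poly_eq_nat (R : numDomainType) (p q : {poly R}) :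
  (forall n : nat, p.[n%:R] = q.[n%:R]) -> p = q.
Proof.
move=> pq; apply/eqP; rewrite -subr_eq0; apply/negP => /negP.
by move=> /poly_nat_nonroot[n]; rewrite hornerD hornerN pq subrr eqxx.
Qed.

Definition fdiff (R : zmodType) (h : R) (f : R -> R) : R -> R :=
  fun x => f (x + h) - f x.

(** Elimination by differences. Subtracting the relation at [(b, t)] from the
    one at [(b - k * s, t + k)] shifts the argument of the function attached to
    the slope [s'] by [k * (s' - s)]: the term of slope [s] cancels, and with
    [k = h / (s0 - s)] the leading function [f] becomes [fdiff h f]. One
    difference of step [h] is thus paid for each slope other than [s0]. The
    functions in [l] are arbitrary because the differences they undergo have
    steps that depend on their slopes. *)
Lemma fdiff_iter_eq0 (R : fieldType) (h s0 : R) (l : seq ((R -> R) * R))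
    (f : R -> R) :
  s0 \notin [seq gs.2 | gs <- l] ->
  (forall b t, f (b + t * s0) + \sum_(gs <- l) gs.1 (b + t * gs.2) = 0) ->
  forall x, iter (size l) (fdiff h) f x = 0.
Proof.
move: {2}(size l) (erefl (size l)) => n.
elim: n l f => [|n IHn] [|[g s] l] f //=.
  by move=> _ _ fE x; rewrite -[RHS](fE x 0) big_nil mul0r !addr0.
move=> [sl]; rewrite inE negb_or => /andP[s0s s0l] fE x.
rewrite -iterS iterSr.
pose k := h / (s0 - s).
pose F (gs : (R -> R) * R) := (fdiff (k * (gs.2 - s)) gs.1, gs.2).
rewrite -(size_map F l); apply: IHn; first by rewrite size_map.
  by rewrite -map_comp (eq_map (_ : _ =1 snd)).
move=> b t; rewrite big_map.
have hE : h = k * (s0 - s) by rewrite divfK// subr_eq0.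
have := fE (b - k * s) (t + k); have := fE b t.
rewrite !big_cons /= => E1 E2.
have E3 gs : b - k * s + (t + k) * gs = b + t * gs + k * (gs - s) by ring.
rewrite !E3 subrr mulr0 addr0 -hE in E2.
have E0 := subrr (0 : R); rewrite -{1}E2 -{2}E1 in E0.
rewrite -[RHS]E0 /fdiff sumrB.
under [in RHS]eq_bigr do rewrite E3.
by rewrite opprD [RHS]addrACA; congr (_ + _); rewrite [g _ + _]addrC addrKA.
Qed.

(** Newton's forward difference formula. Vanishing [N]-th differences are what
    lets the sum stop at an order independent of [k]. *)
Lemma newton_forward (R : comPzRingType) (h : R) (N : nat) (f : R -> R)
    (k : nat) (x : R) :
  (forall y, iter N (fdiff h) f y = 0) ->
  f (x + k%:R * h) = \sum_(j < N) 'C(k, j)%:R * iter j (fdiff h) f x.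
Proof.
case: N => [|N] fN; first by rewrite big_ord0; exact: fN.
elim: k f x fN => [|k IHk] f x fN.
  rewrite mul0r addr0 big_ord_recl big1 ?addr0 ?mul1r// => i _.
  by rewrite lift0 bin0n mul0r.
have -> : f (x + k.+1%:R * h) = f (x + k%:R * h) + fdiff h f (x + k%:R * h).
  by rewrite /fdiff [RHS]addrC subrK mulrSr mulrDl mul1r addrA.
rewrite IHk// IHk; last first.
  move=> y; rewrite -iterSr iterS /fdiff.
  by rewrite -/(fdiff h) !fN subrr.
rewrite big_ord_recl [X in _ + X]big_ord_recr [RHS]big_ord_recl /=.
rewrite -iterSr fN mulr0 addr0 !bin0 -addrA; congr (_ + _).
rewrite -big_split /=; apply: eq_bigr => i _.
by rewrite /bump leq0n add1n -iterSr -mulrDl -natrD binS.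
Qed.

(** The coefficients in Newton's formula are polynomial in the number [k] of
    steps: ['C(k, j)] is the value at [k] of
    ['X * ('X - 1) * ... * ('X - (j - 1))] divided by [j!]. *)
Lemma newton_poly (R : numFieldType) (h : R) (N : nat) (f : R -> R) (x : R) :
  (forall y, iter N (fdiff h) f y = 0) ->
  exists2 p : {poly R}, (size p <= N)%N &
    forall k : nat, f (x + k%:R * h) = p.[k%:R].
Proof.
move=> fN.
exists (\sum_(j < N) (iter j (fdiff h) f x / j`!%:R) *:
          \prod_(i <- iota 0 j) ('X - i%:R%:P)).
  apply: (leq_trans (size_sum _ _ _)); apply/bigmax_leqP => j _.
  apply: (leq_trans (size_scale_leq _ _)).
  by rewrite size_prod_XsubC size_iota.
move=> k; rewrite (newton_forward k x fN) horner_sum; apply: eq_bigr => j _.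
rewrite hornerZ horner_prod mulrC -mulrA; congr (_ * _).
apply: (@mulfI _ j`!%:R); first by rewrite pnatr_eq0 -lt0n fact_gt0.
rewrite mulVKf; last by rewrite pnatr_eq0 -lt0n fact_gt0.
rewrite mulrC -natrM bin_ffact.
elim: (j : nat) => [|i IHi]; first by rewrite big_nil ffactn0.
rewrite -addn1 iotaD big_cat big_seq1 /= -IHi addn1 ffactnSr hornerXsubC.
case: (leqP i k) => ik; first by rewrite natrM natrB.
by rewrite ffact_small// !mul0r.
Qed.

(** Fréchet's characterisation of polynomials. On each grid of step [1 / m]
    that starts at an integer [- M <= 0], [f] agrees with a polynomial by
    Newton's formula; all these polynomials take the same values on the
    naturals, hence are one polynomial [p], which agrees with [f] on the
    rationals, and everywhere by continuity. *)
Lemma frechet_polynomial (R : realType) (N : nat) (f : R -> R) :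
  continuous f -> (forall h x, iter N (fdiff h) f x = 0) ->
  exists2 p : {poly R}, (size p <= N)%N & f = horner p.
Proof.
move=> cf fN; have [p sp fp] := newton_poly 0 (fN 1).
have fnat (n : nat) : f n%:R = p.[n%:R].
  by rewrite -fp add0r mulr1.
have frat (r : rat) : f (ratr r) = p.[ratr r].
  (* r lies on the grid of step 1 / m that starts at - M. *)
  pose M := `|numq r|%N; pose m := `|denq r|%N.
  have m0 : m%:R != 0 :> R by rewrite pnatr_eq0 absz_eq0 denq_neq0.
  have [q _ fq] := newton_poly (- M%:R) (fN m%:R^-1).
  (* The composition changes the variable from the number of steps to the
     position on the line. *)
  have qp : q \Po (m%:R *: 'X + (m * M)%:R%:P) = p.
    apply: poly_eq_nat => n.
    rewrite horner_comp !hornerE -fnat.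
    have -> : m%:R * n%:R + (m * M)%:R = (m * (n + M))%:R :> R.
      by rewrite -natrM -natrD mulnDr.
    by rewrite -fq natrM mulrAC mulfV// mul1r natrD; congr f; ring.
  have [k rk] : exists k : nat, ratr r = - M%:R + k%:R * m%:R^-1 :> R.
    have mM : 0 <= numq r + Posz (M * m).
      have : (M <= M * m)%N by rewrite leq_pmulr// absz_gt0 denq_neq0.
      rewrite /M; lia.
    exists `|(numq r + Posz (M * m))%R|%N.
    rewrite [X in X * _]pmulrn gez0_abs// rmorphD /= mulrDl -pmulrn.
    rewrite natrM mulfK// addrC addrK.
    by rewrite /ratr pmulrn absz_denq.
  have -> : ratr r = - M%:R + k%:R * m%:R^-1 :> R by exact: rk.
  rewrite fq -qp horner_comp !hornerE; congr (q.[_]).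
  by rewrite natrM; field.
apply: contrapT => nfp.
have /existsNP[x fpx] : ~ forall x, f x = p.[x].
  by move=> fpE; apply: nfp; exists p => //; apply/funext.
have [||y [+ [r _ ry]]] := @dense_rat R (fun y => f y - p.[y] != 0).
- by exists x; apply/eqP => /subr0_eq.
- apply: (@open_comp _ _ (fun y => f y - p.[y]) [set z | z != 0]); last first.
    exact: open_neq.
  by move=> y _; apply: cvgB; [exact: cf|exact: continuous_horner].
- by rewrite /= -ry frat subrr eqxx.
Qed.

(** * Activation functions *)

Lemma relu_continuous (R : realType) : continuous (@relu R).
Proof.
by move=> x; apply: continuous_max; [exact: cst_continuous|exact: cvg_id].
Qed.

(** A polynomial that is the identity on the naturals is the identity, but
    ReLU vanishes at [-1]. *)
Lemma relu_not_polynomial (R : realType) : ~ polynomial_fun (@relu R).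
Proof.
move=> [p pE]; have pX : p = 'X.
  by apply: poly_eq_nat => n; rewrite -pE hornerX /relu; apply/max_idPr/ler0n.
have := pE (-1); rewrite pX hornerX /relu max_l ?oppr_le0 ?ler01// => /esym/eqP.
by rewrite oppr_eq0 oner_eq0.
Qed.

Lemma derive1n_horner (R : realType) (p : {poly R}) (n : nat) :
  derive1n n (horner p) = horner p^`(n).
Proof. by elim: n => // n IHn; rewrite derive1nS IHn derivnS derivE. Qed.

Lemma class_C_continuous (R : realType) (l : nat) (sigma : R -> R) :
  class_C l sigma -> continuous sigma.
Proof.
case: l => [[_ //]|l [dsigma _] x].
by apply/differentiable_continuous/derivable1_diffP; exact: (dsigma 0%N).
Qed.

(** * Interpolation by one hidden layer on the line *)

(** A linear relation between the values at [N + 1] fixed points of all the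
    functions [x |-> f (t * x + b)] makes the [N]-th differences of [f] vanish
    for every step: one coefficient is nonzero, and the other [N] slopes are
    eliminated. *)
Lemma annihilated_size_le (R : realType) (N : nat) (f : R -> R)
    (s : 'I_N.+1 -> R) (c : 'I_N.+1 -> R) (j : 'I_N.+1) :
  continuous f -> injective s -> c j != 0 ->
  (forall b t, \sum_i c i * f (t * s i + b) = 0) ->
  exists2 p : {poly R}, (size p <= N)%N & f = horner p.
Proof.
move=> cf sinj cj0 fE; apply: frechet_polynomial => // h x.
pose r := [seq i <- enum 'I_N.+1 | i != j].
pose l := [seq ((fun x => c i / c j * f x), s i) | i <- r].
have sizel : size l = N.
  have := cardC1 j; rewrite card_ord /= => <-.
  by rewrite size_map size_filter -sum1_count big_enum_cond sum1_card.
rewrite -sizel; apply: (@fdiff_iter_eq0 _ _ (s j)).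
  rewrite -map_comp; apply/mapP => -[i].
  by rewrite mem_filter /= => /andP[/eqP ij _] /sinj /esym.
move=> b t; apply: (mulfI cj0); rewrite mulr0 -[RHS](fE b t).
rewrite [RHS](bigD1 j)//= mulrDr [b + _]addrC; congr (_ + _).
rewrite big_map big_filter big_enum_cond mulr_sumr /=; apply: eq_bigr => i _.
by rewrite mulrA mulrCA mulfV// mulr1 addrC.
Qed.

(** The vectors [(f (t * s i + b))_i] span the whole space: as long as the
    chosen rows have rank [n <= N], some nonzero vector annihilates them all,
    and by [annihilated_size_le] it does not annihilate the row of every pair
    [(t, b)]; a row that it does not annihilate raises the rank. *)
Lemma interpolation (R : realType) (N : nat) (f : R -> R) (s : 'I_N.+1 -> R) :
  continuous f -> injective s ->
  (forall p : {poly R}, (size p <= N)%N -> f <> horner p) ->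
  exists (t b : 'I_N.+1 -> R), forall y : 'I_N.+1 -> R,
    exists w : 'I_N.+1 -> R,
      forall i, \sum_k w k * f (t k * s i + b k) = y i.
Proof.
move=> cf sinj nf.
pose A n (t b : 'I_n -> R) : 'M[R]_(n, N.+1) :=
  \matrix_(k, i) f (t k * s i + b k).
have rankA n : (n <= N.+1)%N -> exists t b : 'I_n -> R, \rank (A n t b) = n.
  elim: n => [|n IHn] nN.
    by exists (fun=> 0), (fun=> 0); apply/eqP; rewrite -leqn0 rank_leq_row.
  have [t [b rA]] := IHn (ltnW nN).
  have [j cj] : exists j, col j (cokermx (A n t b)) != 0.
    apply: contrapT => /forallNP cok0.
    have /eqP : cokermx (A n t b) = 0.
      apply/matrixP => i j; have /negP := cok0 j; rewrite negbK => /eqP.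
      by move=> /matrixP/(_ i 0); rewrite !mxE.
    by rewrite -mxrank_eq0 mxrank_coker rA subn_eq0 leqNgt nN.
  have [u cu] : exists u, cokermx (A n t b) u j != 0.
    apply: contrapT => /forallNP c0; move/negP: cj; apply.
    apply/eqP/matrixP => i k.
    by rewrite mxE [RHS]mxE; apply/eqP/negPn/negP/c0.
  have [b' [t' fbt]] : exists b' t',
      \sum_i cokermx (A n t b) i j * f (t' * s i + b') != 0.
    apply: contrapT => nbt.
    pose v i := cokermx (A n t b) i j.
    have [|p sp fp] := annihilated_size_le (c := v) cf sinj cu; last first.
      exact: nf sp fp.
    move=> b' t'; apply: contrapT => fbt; apply: nbt; exists b', t'; exact/eqP.
  (* The new neuron gets index 0. *)
  exists (fun k => oapp t t' (unlift ord0 k)).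
  exists (fun k => oapp b b' (unlift ord0 k)).
  set B := A n.+1 _ _.
  have AB : (A n t b < B)%MS.
    apply/andP; split.
      apply/row_subP => k; have -> : row k (A n t b) = row (lift ord0 k) B.
        by apply/rowP => i; rewrite !mxE liftK.
      exact: row_sub.
    rewrite submxE; apply/negP => /eqP/matrixP/(_ ord0 j).
    rewrite mxE [RHS]mxE => /eqP.
    apply/negP; apply: contra fbt => /eqP E; apply/eqP.
    rewrite -[RHS]E; apply: eq_bigr => i _.
    by rewrite [B _ _]mxE unlift_none /= mulrC.
  apply/eqP; rewrite eqn_leq rank_leq_row /= -[X in (X < _)%N]rA.
  exact: rank_ltmx.
have [t [b rA]] := rankA N.+1 (leqnn _).
exists t, b => y.
have /row_fullP[B BA] : row_full (A _ t b) by rewrite /row_full rA.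
exists (fun k => ((\row_i y i) *m B) 0 k) => i.
have /matrixP/(_ 0 i) : (\row_i y i) *m B *m A N.+1 t b = \row_i y i.
  by rewrite -mulmxA BA mulmx1.
rewrite mxE [in RHS]mxE => <-; apply: eq_bigr => k _.
by rewrite [A _ _ _ _ _]mxE.
Qed.

(** * Networks with prescribed values at finitely many points *)

(** Some point of the moment curve [(1, n, n ^ 2, ...)] works: two of the
    points have the same image only if [n] is a root of the nonzero polynomial
    whose coefficients are those of their difference. *)
Lemma separating_direction (R : realType) (d : nat) (xs : seq 'cV[R]_d) :
  exists w : 'rV[R]_d, {in xs &, injective (fun x => (w *m x) 0 0)}.
Proof.
pose P := \prod_(x <- xs) \prod_(y <- xs | x != y) rVpoly (x - y)^T.
have P0 : P != 0.
  rewrite prodf_seq_neq0; apply/allP => x _ /=.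
  rewrite prodf_seq_neq0; apply/allP => y _; apply/implyP => xy.
  apply: contra xy => /eqP /(congr1 (poly_rV (d := d))).
  by rewrite rVpolyK linear0 -trmx0 => /trmx_inj/subr0_eq ->.
have [n Pn] := poly_nat_nonroot P0.
exists (\row_k n%:R ^+ k) => x y xxs yxs /= wxy.
apply/eqP/negPn/negP => xy.
move: Pn; rewrite horner_prod prodf_seq_neq0 => /allP/(_ _ xxs) /=.
rewrite horner_prod prodf_seq_neq0 => /allP/(_ _ yxs); rewrite xy /=.
apply/negP; rewrite negbK horner_poly; apply/eqP.
move: wxy; rewrite !mxE => wxy.
rewrite -[RHS](subrr (\sum_j (\row_k n%:R ^+ k) 0 j * x j 0)).
rewrite {2}wxy -sumrB; apply: eq_bigr => i _.
by rewrite valK !mxE -mulrBr mulrC.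
Qed.

(** What an activation has to satisfy for finite sets of points to be carried
    without collision through a layer of width one. The shift [b] is what lets
    ReLU qualify: it moves the points to the half-line where ReLU is the
    identity. *)
Definition separating (R : realType) (f : R -> R) : Prop :=
  forall r : seq R, exists b, {in r &, injective (fun x => f (x + b))}.

Lemma strictly_monotone_separating (R : realType) (f : R -> R) :
  strictly_monotone f -> separating f.
Proof.
move=> fmono r; exists 0 => x y _ _; rewrite !addr0 => fxy.
apply/eqP; case: ltgtP => // xy; case: fmono => /(_ _ _ xy);
  by rewrite fxy ltxx.
Qed.

Lemma relu_separating (R : realType) : separating (@relu R).
Proof.
move=> r; pose b := \sum_(x <- r) `|x|; exists b.
have rb x : x \in r -> 0 <= x + b.
  move=> xr; rewrite /b (big_rem x)//= addrA addr_ge0 ?sumr_ge0//.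
  by have := ler_norm (- x); rewrite normrN -subr_ge0 opprK addrC.
move=> x y xr yr; rewrite /relu !max_r ?rb//; exact: addIr.
Qed.

(** Inversion principle. At depth 0 the identity of the width [n] with [d] is
    replaced by a matrix [P], which avoids transport along that equality. *)
Lemma hidden_layer_inv (R : realType) (sigma : R -> R) (d : nat) (i n : nat)
    (phi : 'cV[R]_d -> 'cV[R]_n) :
  hidden_layer sigma i phi ->
  match i with
  | 0%N => exists P : 'M[R]_(n, d), phi = (fun x => P *m x)
  | i.+1 => exists m (psi : 'cV[R]_d -> 'cV[R]_m) (W : 'M[R]_(n, m))
              (b : 'cV[R]_n), [/\ (0 < n)%N, hidden_layer sigma i psi
              & phi = (fun x => map_mx sigma (W *m psi x + b))]
  end.
Proof.
case=> {i n phi} [|i m n psi W b n0 hpsi].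
  by exists 1%:M; apply/funext => x; rewrite mul1mx.
by exists m, psi, W, b.
Qed.

(** Networks of equal depth can be run side by side: beyond depth 0 the hidden
    maps are stacked, the matrices [P] and [Q] being the coordinate
    projections. Returning the projections lets the induction start at depth 0,
    where stacking is impossible since the input must be shared. *)
Lemma hidden_layer_join (R : realType) (sigma : R -> R) (d : nat)
    (i m n : nat) (phi : 'cV[R]_d -> 'cV[R]_m) (psi : 'cV[R]_d -> 'cV[R]_n) :
  hidden_layer sigma i phi -> hidden_layer sigma i psi ->
  exists k (chi : 'cV[R]_d -> 'cV[R]_k) (P : 'M[R]_(m, k)) (Q : 'M[R]_(n, k)),
    [/\ hidden_layer sigma i chi, phi = (fun x => P *m chi x)
      & psi = (fun x => Q *m chi x)].
Proof.
elim: i m n phi psi => [|i IHi] m n phi psi.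
  move=> /hidden_layer_inv[P ->] /hidden_layer_inv[Q ->].
  by exists d, id, P, Q; split => //; exact: hidden_layer0.
move=> /hidden_layer_inv[m' [phi' [V [a [m0 hphi ->]]]]].
move=> /hidden_layer_inv[n' [psi' [W [b [n0 hpsi ->]]]]].
have [k [chi [P [Q [hchi -> ->]]]]] := IHi _ _ _ _ hphi hpsi.
exists (m + n)%N.
exists (fun x => map_mx sigma (col_mx (V *m P) (W *m Q) *m chi x + col_mx a b)).
exists (row_mx 1%:M 0), (row_mx 0 1%:M); split.
- by apply: hidden_layerS hchi; rewrite addn_gt0 m0.
- apply/funext => x; rewrite mul_col_mx add_col_mx map_col_mx mul_row_col.
  by rewrite mul1mx mul0mx addr0 mulmxA.
- apply/funext => x; rewrite mul_col_mx add_col_mx map_col_mx mul_row_col.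
  by rewrite mul1mx mul0mx add0r mulmxA.
Qed.

Lemma neural_network_lincomb (R : realType) (sigma : R -> R) (d : nat)
    (c L : nat) (f g : 'cV[R]_d -> 'cV[R]_c) (a : R) :
  neural_network sigma L f -> neural_network sigma L g ->
  neural_network sigma L (fun x => f x + a *: g x).
Proof.
move=> [m [phi [V [u [hphi ->]]]]] [n [psi [W [v [hpsi ->]]]]].
have [k [chi [P [Q [hchi -> ->]]]]] := hidden_layer_join hphi hpsi.
exists k, chi, (V *m P + a *: (W *m Q)), (u + a *: v); split => //.
apply/funext => x; rewrite scalerDr addrACA mulmxDl -!scalemxAl.
by rewrite !mulmxA.
Qed.

Lemma separating_hidden_layer (R : realType) (sigma : R -> R) (d : nat)
    (xs : seq 'cV[R]_d) (i : nat) :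
  ((0 < i)%N -> separating sigma) ->
  exists m (phi : 'cV[R]_d -> 'cV[R]_m) (w : 'rV[R]_m),
    hidden_layer sigma i phi /\
    {in xs &, injective (fun x => (w *m phi x) 0 0)}.
Proof.
elim: i => [_|i IHi sep].
  have [w winj] := separating_direction xs.
  by exists d, id, w; split => //; exact: hidden_layer0.
have [m [phi [w [hphi winj]]]] := IHi (fun=> sep isT).
have [b binj] := sep isT [seq (w *m phi x) 0 0 | x <- xs].
exists 1%N, (fun x => map_mx sigma (w *m phi x + const_mx b)), 1%:M; split.
  exact: hidden_layerS hphi.
move=> x y xxs yxs; rewrite !mul1mx.
have layerE z : map_mx sigma (w *m phi z + const_mx b) 0 0 =
    sigma ((w *m phi z) 0 0 + b) by rewrite mxE mxE [const_mx _ _ _]mxE.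
rewrite !layerE => sxy; apply: winj => //; apply: binj sxy.
  exact: (map_f (fun z => (w *m phi z) 0 0) xxs).
exact: (map_f (fun z => (w *m phi z) 0 0) yxs).
Qed.

(** The first [L - 2] hidden layers, together with a linear form [w], map the
    points to distinct reals; the last hidden layer and the output layer then
    interpolate on the line, each output coordinate with its own weights but
    all with the same hidden neurons. *)
Lemma neural_network_interpolation (R : realType) (sigma : R -> R) (d : nat)
    (c L N : nat) (x : 'I_N.+1 -> 'cV[R]_d)
    (y : 'I_N.+1 -> 'cV[R]_c) :
  (2 <= L)%N -> ((2 < L)%N -> separating sigma) -> continuous sigma ->
  (forall p : {poly R}, (size p <= N)%N -> sigma <> horner p) ->
  injective x ->
  exists2 f, neural_network sigma L f & forall i, f (x i) = y i.
Proof.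
case: L => [|[|L]]// _ sep csigma nsigma xinj.
have [m [phi [w [hphi winj]]]] :=
  @separating_hidden_layer _ sigma _ (codom x) L sep.
pose s i := (w *m phi (x i)) 0 0.
have sinj : injective s.
  by move=> i j sij; apply/xinj/winj; rewrite ?codom_f.
have [t [b tb]] := interpolation csigma sinj nsigma.
have /choice[W WE] := fun j => tb (fun i => y i j 0).
exists (fun z => (\matrix_(j, k) W j k) *m
   map_mx sigma ((\col_k t k *m w) *m phi z + \col_k b k) + 0).
  exists N.+1.
  exists (fun z => map_mx sigma ((\col_k t k *m w) *m phi z + \col_k b k)).
  by do 2 eexists; split; [exact: hidden_layerS hphi|].
move=> i; rewrite addr0; apply/colP => j; rewrite mxE -WE.
apply: eq_bigr => k _; rewrite mxE mxE mxE [(\col_k b k) _ _]mxE -mulmxA.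
by rewrite [(\col_k t k *m _) _ _]mxE big_ord1 [(\col_k t k) _ _]mxE.
Qed.

(** * Perturbation of a minimizer *)

Lemma infinite_range (T : Type) (F : nat -> T) :
  injective F -> infinite_set (range F).
Proof.
move=> Finj; have /eq_finite_set -> : (range F #= [set: nat])%card.
  by apply: inj_card_eq => x y _ _; exact: Finj.
exact: infinite_nat.
Qed.

Lemma open_infinite (R : realType) (d : nat) (A : set 'cV[R]_d.+1) :
  A !=set0 -> open A -> infinite_set A.
Proof.
move=> [p Ap] /(_ p Ap)/nbhs_ballP[r /= r0 rA].
pose F n : 'cV[R]_d.+1 := p + const_mx (r / n.+2%:R).
apply: (@sub_infinite_set _ (range F)); last first.
  apply: infinite_range => m n /addrI/matrixP/(_ 0 0); rewrite !mxE.
  move=> /(mulfI (lt0r_neq0 r0))/invr_inj/eqP.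
  by rewrite eqr_nat => /eqP[].
move=> _ [n _ <-]; apply: rA; split => // i j; rewrite !mxE -ball_normE /=.
rewrite opprD addNKr normrN gtr0_norm ?divr_gt0//.
by rewrite ltr_pdivrMr// ltr_pMr// ltr1n.
Qed.

Lemma notin_fset_exists (R : realType) (d : nat) (A : set 'cV[R]_d)
    (Z : {fset 'cV[R]_d}) :
  (0 < d)%N -> A !=set0 -> open A -> exists2 y, A y & y \notin Z.
Proof.
case: d A Z => // d A Z _ A0 oA; apply: contrapT => AZ.
apply: (open_infinite A0 oA); apply: sub_finite_set (finite_fset Z) => y Ay /=.
by apply: contrapT => yZ; apply: AZ; exists y => //; exact/negP.
Qed.

Lemma network_bump (R : realType) (sigma : R -> R) (d c L : nat)
    (Z : {fset 'cV[R]_d}) (y : 'cV[R]_d) (v : 'cV[R]_c) :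
  (2 <= L)%N -> ((2 < L)%N -> separating sigma) -> continuous sigma ->
  (forall p : {poly R}, (size p <= #|` Z|)%N -> sigma <> horner p) ->
  y \notin Z ->
  exists g, [/\ neural_network sigma L g, g y = v
              & forall z, z \in Z -> g z = 0].
Proof.
move=> L2 sep csigma nsigma yZ.
pose s := y :: enum_fset Z.
have us : uniq s by rewrite /= yZ fset_uniq.
pose x (i : 'I_(#|` Z|).+1) := nth y s i.
have xinj : injective x.
  by move=> i j /eqP; rewrite nth_uniq// => /eqP/val_inj.
have [g gN gE] := neural_network_interpolation
  (fun i => if i == ord0 then v else 0) L2 sep csigma nsigma xinj.
exists g; split => // [|z zZ]; first exact: (gE ord0).
have zs : (index z (enum_fset Z) < #|` Z|)%N by rewrite index_mem.
by have := gE (lift ord0 (Ordinal zs)); rewrite /x /= nth_index.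
Qed.

Lemma eq_fdpinn_loss (R : realType) (d c cF cB : nat)
    (Oh Gh Dh : {fset 'cV[R]_d}) (nu alphaF alphaB alphaD : R)
    (Fh : ((Oh `|` Gh)%fset -> 'cV[R]_c) -> Oh -> 'cV[R]_cF)
    (Bh : ((Oh `|` Gh)%fset -> 'cV[R]_c) -> Gh -> 'cV[R]_cB)
    (omegaF : Oh -> R) (omegaB : Gh -> R) (omegaD : Dh -> R)
    (ustar : Dh -> 'cV[R]_c) (u v : 'cV[R]_d -> 'cV[R]_c) :
  (Dh `<=` Oh `|` Gh)%fset -> {in (Oh `|` Gh)%fset, u =1 v} ->
  fdpinn_loss nu alphaF alphaB alphaD Fh Bh omegaF omegaB omegaD ustar u =
  fdpinn_loss nu alphaF alphaB alphaD Fh Bh omegaF omegaB omegaD ustar v.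
Proof.
move=> hDh uv; rewrite /fdpinn_loss.
have -> : (fun z : (Oh `|` Gh)%fset => u (fsval z)) = (fun z => v (fsval z)).
  by apply/funext => z; exact/uv/fsvalP.
have uvD (z : Dh) : u (fsval z) = v (fsval z).
  exact/uv/(fsubsetP hDh)/fsvalP.
by under [X in _ + alphaD * X = _]eq_bigr do rewrite uvD.
Qed.

Theorem theorem4p4 (R : realType) (d c cF cB : nat)
    (Omega Gamma : set 'cV[R]_d) (Oh Gh Dh : {fset 'cV[R]_d})
    (nu alphaF alphaB alphaD : R)
    (Fh : ((Oh `|` Gh)%fset -> 'cV[R]_c) -> Oh -> 'cV[R]_cF)
    (Bh : ((Oh `|` Gh)%fset -> 'cV[R]_c) -> Gh -> 'cV[R]_cB)
    (omegaF : Oh -> R) (omegaB : Gh -> R) (omegaD : Dh -> R)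
    (ustar : Dh -> 'cV[R]_c) (L : nat) (sigma : R -> R)
    (hd : (0 < d)%N) (hc : (0 < c)%N)
    (hOmega : lipschitz_domain Omega)
    (hGamma : Gamma `<=` boundary Omega)
    (hOh : [set` Oh] `<=` Omega)
    (hGh : [set` Gh] `<=` Gamma)
    (hdisj : [disjoint Oh & Gh]%fset)
    (hDh : (Dh `<=` Oh `|` Gh)%fset)
    (hnu : 1 <= nu)
    (haF : 0 <= alphaF) (haB : 0 <= alphaB) (haD : 0 <= alphaD)
    (hL : (2 <= L)%N)
    (hsigma :
      [\/ sigma = @relu R,
          [/\ continuous sigma, ~ polynomial_fun sigma
            & (2 < L)%N -> strictly_monotone sigma]
        | [/\ class_C #|` (Oh `|` Gh)%fset| sigma,
              (exists a : R, forall k, (k <= #|` (Oh `|` Gh)%fset|)%N ->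
                 derive1n k sigma a != 0)
            & (2 < L)%N -> strictly_monotone sigma]]) :
  let J := fdpinn_loss nu alphaF alphaB alphaD Fh Bh omegaF omegaB omegaD ustar in
  let H := @network_class R sigma d c L Omega in
  argmin H J !=set0 -> infinite_set (argmin H J).
Proof.
move=> J H [_ [[f fN <-] fmin]]; set Z := (Oh `|` Gh)%fset in hsigma.
have [csigma nsigma sep] : [/\ continuous sigma,
    forall p : {poly R}, (size p <= #|` Z|)%N -> sigma <> horner p
    & (2 < L)%N -> separating sigma].
  case: hsigma => [->|[cs ns ms]|[Cs [a sa] ms]].
  - split; [exact: relu_continuous| |by move=> _; exact: relu_separating].
    by move=> p _ pE; apply: (@relu_not_polynomial R); exists p => x; rewrite pE.
  - split => [//||/ms]; last exact: strictly_monotone_separating.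
    by move=> p _ pE; apply: ns; exists p => x; rewrite pE.
  - split; [exact: class_C_continuous Cs| |]; last first.
      by move=> /ms; exact: strictly_monotone_separating.
    move=> p sp pE; have := sa _ (leqnn _).
    by rewrite pE derive1n_horner derivn_poly0// horner0 eqxx.
case: hOmega => Omega0 oOmega _ _ _.
have [y Oy yZ] := notin_fset_exists Z hd Omega0 oOmega.
have [g [gN gy gZ]] :=
  network_bump (const_mx 1 : 'cV[R]_c) hL sep csigma nsigma yZ.
have ZOmega (z : 'cV[R]_d) : z \in Z -> closure Omega z.
  rewrite in_fsetU => /orP[zO|zG]; first exact/subset_closure/hOh.
  by case: (hGamma _ (hGh _ zG)).
pose u (n : nat) := (fun x => f x + n%:R *: g x) \_ (closure Omega).
apply: (@sub_infinite_set _ (range u)); last first.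
  apply: infinite_range => m n.
  move=> /(congr1 (fun w : 'cV[R]_d -> 'cV[R]_c => w y (Ordinal hc) 0)).
  rewrite /u !patchE !mem_set//; try exact: subset_closure.
  rewrite gy !mxE !mulr1 => /addrI/eqP.
  by rewrite eqr_nat => /eqP.
move=> _ [n _ <-]; split.
  by exists (fun x => f x + n%:R *: g x) => //; exact: neural_network_lincomb.
have -> : J (u n) = J (f \_ (closure Omega)); last exact: fmin.
apply: eq_fdpinn_loss => // z zZ; rewrite /u !patchE mem_set; last exact: ZOmega.
by rewrite gZ// scaler0 addr0.
Qed.
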